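(* In the AI-augmented cascade model with symmetric prior $\ell_0=0$ and $q,\alpha\in(\tfrac12,1)$, let $D_\infty=\lim_{j\to\infty}\operatorname{sign}(P_j)$ be the final cascade direction. (a) If $\alpha\ge q$, then for any fixed AI prediction $c$, $D_\infty=\operatorname{sign}(\lambda(c;\alpha))$. (b) If $\tfrac12<\alpha<q$, then, for fixed $c$ and $\theta$, $$\Pr\bigl(D_\infty=\operatorname{sign}(\lambda(c;\alpha))\mid c,\theta\bigr)=\begin{cases}\dfrac{q}{1-q+q^2}, & c=\theta,\\[6pt] \dfrac{1-q}{1-q+q^2}, & c\ne\theta.\end{cases}$$
   Context: AI-augmented cascade model. A binary state $\theta\in\{0,1\}$ has prior $\pi_0=\Pr(\theta=1)$, $\ell_0=\log\frac{\pi_0}{1-\pi_0}$. Users $i=1,2,\dots$ act sequentially. User $i$ has a private signal $s_i\in\{0,1\}$ with $\Pr(s_i=\theta\mid\theta)=q$; there is one common AI signal $c\in\{0,1\}$ with $\Pr(c=\theta\mid\theta)=\alpha$, seen by every user; given $\theta$, the variables $c,s_1,s_2,\dots$ are mutually independent. User $i$ observes $s_i$, $c$ and the public history $(J_1,\dots,J_{i-1})$. Write $L_\rho=\log\frac{\rho}{1-\rho}$ and $\lambda(x;\rho)=(2x-1)L_\rho$ for $x\in\{0,1\}$. The public log-odds are $P_i=\ell_0+\lambda(c;\alpha)+\sum_{j<i}\psi_j(J_j)$, where $\psi_j(J_j)=\log\frac{\Pr(J_j\mid\theta=1,P_j)}{\Pr(J_j\mid\theta=0,P_j)}$ (probabilities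 conditional on the public log-odds $P_j$ under which user $j$ acted). User $i$'s posterior log-odds are $\ell_i=P_i+\lambda(s_i;q)$, and her judgment is $J_i=1$ if $\ell_i>0$, $J_i=0$ if $\ell_i<0$, and $J_i=\mathbf 1\{P_i\ge0\}$ if $\ell_i=0$. $D_\infty=+1$ if the process $(P_j)$ is absorbed in the up-cascade region $\{P\ge L_q\}$ and $D_\infty=-1$ if it is absorbed in the down-cascade region $\{P\le -L_q\}$; absorption occurs almost surely. *)

(* Defs.v *)
From HB Require Import structures.
From mathcomp Require Import all_boot all_order all_algebra.
From mathcomp Require Import all_classical all_reals all_analysis.

Set Implicit Arguments.
Unset Strict Implicit.
Unset Printing Implicit Defensive.

Import Order.TTheory GRing.Theory Num.Theory.
Import numFieldNormedType.Exports.

Local Open Scope classical_set_scope.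
Local Open Scope ring_scope.

(* Pr(A | B); junk value 0 when P B = 0. *)
Definition cond_prob d (T : measurableType d) (R : realType)
    (P : probability T R) (A B : set T) : R :=
  fine (P (A `&` B)) / fine (P B).

(* Mutual independence of a family of binary random variables conditionally on
   the event B. Every set of booleans is measurable, so the sets E k range over
   all measurable events of the variables. *)
Definition cond_mutual_independence d (T : measurableType d) (R : realType)
    (P : probability T R) (B : set T) (K : choiceType)
    (X : K -> {RV P >-> bool}) : Prop :=
  forall (ks : seq K) (E : K -> set bool), uniq ks ->
    cond_prob P (\big[setI/setT]_(k <- ks) (X k @^-1` E k)) B =
    \prod_(k <- ks) cond_prob P (X k @^-1` E k) B.

Section LogOdds.
Context {R : realType}.

Definition log_odds (rho : R) : R := ln (rho / (1 - rho)).

Definition lambda (x : bool) (rho : R) : R := (2 * x%:R - 1) * log_odds rho.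

(* Judgment of a user with private signal x facing the public log-odds p. *)
Definition judgment (q p : R) (x : bool) : bool :=
  let l := p + lambda x q in
  if 0 < l then true else if l < 0 then false else 0 <= p.

End LogOdds.

Section Cascade.
Context d (T : measurableType d) (R : realType) (P : probability T R).
Variables (theta c : {RV P >-> bool}) (s : nat -> {RV P >-> bool}).
Variables (pi0 q alpha : R).

(* The AI signal (None) together with the private signals. Users are numbered
   from 0, so that s i is the signal of the (i+1)-st user. *)
Definition signal (k : option nat) : {RV P >-> bool} :=
  if k is Some i then s i else c.

Record cascade_model : Prop := CascadeModel {
  prior_interior : 0 < pi0 < 1 ;
  prior_state : P (theta @^-1` [set true]) = pi0%:E ;
  private_accuracy : forall i t,
    cond_prob P (s i @^-1` [set t]) (theta @^-1` [set t]) = q ;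
  AI_accuracy : forall t,
    cond_prob P (c @^-1` [set t]) (theta @^-1` [set t]) = alpha ;
  signals_independent : forall t,
    cond_mutual_independence (theta @^-1` [set t]) signal
}.

(* Evidence carried by the value J w of a judgment J made under the public
   log-odds p: the conditioning event is {theta = t, p = p w}. *)
Definition evidence (p : T -> R) (J : T -> bool) (w : T) : R :=
  let lik t := cond_prob P (J @^-1` [set J w])
                 (theta @^-1` [set t] `&` p @^-1` [set p w]) in
  ln (lik true / lik false).

Fixpoint public_log_odds (i : nat) : T -> R :=
  if i is j.+1 then
    fun w => public_log_odds j w +
      evidence (public_log_odds j)
               (fun w' => judgment q (public_log_odds j w') (s j w')) w
  else fun w => log_odds pi0 + lambda (c w) alpha.

Definition user_judgment (i : nat) (w : T) : bool :=
  judgment q (public_log_odds i w) (s i w).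

Lemma public_log_oddsE i w :
  public_log_odds i w = log_odds pi0 + lambda (c w) alpha +
    \sum_(j < i) evidence (public_log_odds j) (user_judgment j) w.
Proof.
by elim: i => [|i IH]; rewrite ?big_ord0 ?addr0// big_ord_recr addrA -IH.
Qed.

(* When the signs do not converge this is the default value 0, which is not a
   direction (see final_directionP). *)
Definition final_direction (w : T) : R :=
  limn (fun j => Num.sg (public_log_odds j w)).

Lemma final_directionP w (e : R) : e != 0 ->
  final_direction w = e <->
  (fun j => Num.sg (public_log_odds j w)) @ \oo --> e.
Proof.
move=> e0; split=> [De|]; last exact/cvg_lim.
rewrite -De; apply: contrapT => /dvgP De0.
by move: e0; rewrite -De /final_direction De0 eqxx.
Qed.

Lemma log_odds_gt0 (rho : R) : 1 / 2 < rho < 1 -> 0 < log_odds rho.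
Proof.
move=> /andP[h1 h2]; apply: ln_gt0; rewrite ltr_pdivlMr ?subr_gt0// mul1r.
by rewrite ltrBlDr -mulr2n -mulr_natr -ltr_pdivrMr.
Qed.

Lemma final_direction_up w : 1 / 2 < q < 1 ->
  (\forall j \near \oo, log_odds q <= public_log_odds j w) ->
  final_direction w = 1.
Proof.
move=> /log_odds_gt0 q0 up; apply/final_directionP; rewrite ?oner_eq0//.
apply: cvg_near_cst; apply: filterS up => j up.
by rewrite gtr0_sg// (lt_le_trans q0).
Qed.

Lemma final_direction_down w : 1 / 2 < q < 1 ->
  (\forall j \near \oo, public_log_odds j w <= - log_odds q) ->
  final_direction w = -1.
Proof.
move=> /log_odds_gt0 q0 down; apply/final_directionP; rewrite ?oppr_eq0 ?oner_eq0//.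
apply: cvg_near_cst; apply: filterS down => j down.
by rewrite ltr0_sg// (le_lt_trans down)// oppr_lt0.
Qed.

End Cascade.

(* Main.v *)
(* Write L_r for the log-odds of r and orient everything by the AI signal, so
   that the walk starts at L_alpha > 0. If alpha >= q it starts in a cascade,
   where judgments carry no evidence, and never moves. If alpha < q, an
   undecided user follows her own signal, whose evidence is +- L_q; the only
   undecided positions are L_alpha (at even times) and L_alpha - L_q (at odd
   times), so the walk joins the AI exactly when, after 2k alternating signals,
   user 2k agrees with the AI. With r the probability that a private signal
   agrees with the AI, this has probability
   sum_k (r (1 - r))^k r = r / (1 - q (1 - q)). *)
Require Import Defs.
From mathcomp Require Import all_boot all_order all_algebra.
From mathcomp Require Import all_classical all_reals all_analysis.
From mathcomp Require Import lra ring.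

Set Implicit Arguments.
Unset Strict Implicit.
Unset Printing Implicit Defensive.

Import Order.TTheory GRing.Theory Num.Theory.
Import numFieldNormedType.Exports.

Local Open Scope classical_set_scope.
Local Open Scope ring_scope.

(** * Conditional probability of a complement *)

Section ConditionalProbability.
Context d (T : measurableType d) (R : realType) (P : probability T R).

Lemma cond_prob_setC (A B : set T) : measurable A -> measurable B ->
  fine (P B) != 0 -> cond_prob P (~` A) B = 1 - cond_prob P A B.
Proof.
move=> mA mB B0; rewrite /cond_prob -[X in _ = X - _](divff B0) -mulrBl.
congr (_ / _); apply/eqP; rewrite -subr_eq opprK -fineD; last 2 first.
- by apply: fin_num_measure; apply: measurableI => //; exact: measurableC.
- by apply: fin_num_measure; apply: measurableI.
rewrite -measureU; last 3 first.
- by apply: measurableI => //; exact: measurableC.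
- exact: measurableI.
- by rewrite setIACA setICl set0I.
by rewrite -setIUl setvU setTI.
Qed.

End ConditionalProbability.

(** * Judgments, likelihoods and orientation by the AI signal *)

Section Judgment.
Context {R : realType}.
Implicit Types (q p r : R) (x b t : bool).

(** Reflects the line when the AI signal is 0, so that both of its values are treated as one
    case. *)
Definition orient x r : R := if x then r else - r.

Lemma orientK x : involutive (orient x).
Proof. by case: x => r; rewrite /orient ?opprK. Qed.

Lemma norm_orient x r : `|orient x r| = `|r|.
Proof. by case: x; rewrite /orient ?normrN. Qed.

Lemma ler_norm_orient x r r' : r' <= orient x r -> r' <= `|r|.
Proof. by move=> r'r; rewrite -(norm_orient x) ler_normr r'r. Qed.

Lemma lambdaE x r : lambda x r = orient x (log_odds r).
Proof. by case: x; rewrite /lambda /=; lra. Qed.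

(** At [p = log_odds q] a contrary signal gives posterior log-odds 0, and the tie is broken by the
    sign of [p]; hence the closed bound. *)
Lemma judgment_up q p x : 0 < log_odds q -> log_odds q <= p ->
  judgment q p x = true.
Proof.
rewrite /judgment lambdaE /orient => q0 qp; case: ltP => //; case: ltP => //;
  case: x; rewrite ?andbT; lra.
Qed.

Lemma judgment_down q p x : 0 < log_odds q -> p <= - log_odds q ->
  judgment q p x = false.
Proof.
rewrite /judgment lambdaE /orient => q0 qp; case: ltP; first by case: x; lra.
by case: ltP => // _ _; apply/negbTE; rewrite -ltNge; lra.
Qed.

Lemma judgment_free q p x : `|p| < log_odds q -> judgment q p x = x.
Proof.
rewrite ltr_norml /judgment lambdaE /orient => /andP[q1 q2].
by case: x; case: ltP => //; [lra|lra|case: ltP => //; lra].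
Qed.

(* The probability that a signal of accuracy r takes the value b in state t. *)
Definition likelihood (r : R) (b t : bool) : R := if b == t then r else 1 - r.

Lemma ln_likelihood r b : 0 < r < 1 ->
  ln (likelihood r b true / likelihood r b false) = lambda b r.
Proof.
move=> /andP[r0 r1]; rewrite lambdaE /orient /log_odds /likelihood; case: b => //=.
rewrite -lnV ?invf_div//.
by rewrite qualifE/= divr_gt0// subr_gt0.
Qed.

End Judgment.

(** * Positions and exits of the alternating walk *)

Section UndecidedWalk.
Context {R : realType} (a b : R) (x : bool).
Hypothesis a_gt0 : 0 < a.
Hypothesis ab : a < b.

(* The only public log-odds at which the users still disagree: they alternate
   between a and a - b, up to the orientation given by the AI signal x. *)
Definition undecided (j : nat) : R := orient x (a - (odd j)%:R * b).

(** The signals that keep the walk undecided: even users contradict the AI, odd users agree with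
    it. *)
Definition alternating (i : nat) : bool := x == odd i.

Lemma undecided_small j : `|undecided j| < b.
Proof.
move: a_gt0 ab => a0 lt_ab.
rewrite /undecided norm_orient ltr_norml.
by case: (odd j); rewrite /= ?mul1r ?mul0r; apply/andP; split; lra.
Qed.

Lemma undecidedS j :
  undecided j + orient (alternating j) b = undecided j.+1.
Proof.
move: a_gt0 ab => a0 lt_ab.
rewrite /undecided /alternating /orient /=.
by case: x; case: (odd j); rewrite /= ?mul1r ?mul0r; lra.
Qed.

Lemma undecided_join j y : ~~ odd j -> y = x ->
  undecided j + orient y b = orient x (a + b).
Proof.
move: a_gt0 ab => a0 lt_ab.
by rewrite /undecided /orient => /negbTE -> ->; case: x;
   rewrite /= mul0r; lra.
Qed.

(** Up to orientation, an odd user who contradicts the AI moves the walk from [a - b] to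
    [a - 2 * b], and [a < b]. *)
Lemma undecided_leave j y : odd j -> y != alternating j ->
  orient x (undecided j + orient y b) <= - b.
Proof.
move: a_gt0 ab => a0 lt_ab.
rewrite /undecided /alternating /orient => -> yx; move: yx.
by case: x; case: y => //= _; rewrite mul1r; lra.
Qed.

Lemma undecided_odd_lt0 j : odd j -> orient x (undecided j) < 0.
Proof.
move: a_gt0 ab => a0 lt_ab.
by rewrite /undecided orientK => ->; rewrite mul1r; lra.
Qed.

Lemma undecided_exit j y : y != alternating j ->
  b <= `|undecided j + orient y b|.
Proof.
move: a_gt0 ab => a0 lt_ab.
move=> yj; have [oj|ej] := boolP (odd j).
  apply: (@ler_norm_orient _ (~~ x)); have := undecided_leave oj yj.
  by rewrite /orient; case: x => /=; lra.
rewrite undecided_join//; last first.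
  by move: yj; rewrite /alternating (negbTE ej); case: x; case: y.
by rewrite norm_orient ler_normr; apply/orP; left; lra.
Qed.

Lemma sgr_orient_joined : Num.sg (orient x (a + b)) = Num.sg (orient x a).
Proof.
move: a_gt0 ab => a0 lt_ab.
rewrite /orient; case: x; last rewrite !sgrN.
  by rewrite !gtr0_sg//; lra.
by rewrite !gtr0_sg//; lra.
Qed.

(** Opposite signs are at distance 2; this serves to refute convergence to the sign of the AI
    signal. *)
Lemma sgr_orient_far p : orient x p < 0 ->
  1 < `|Num.sg (orient x a) - Num.sg p|.
Proof.
move: a_gt0 => a0.
rewrite /orient; case: x => p0.
  by rewrite (gtr0_sg a_gt0) ltr0_sg// ger0_norm; lra.
rewrite sgrN (gtr0_sg a_gt0) gtr0_sg ?ler0_norm; lra.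
Qed.

End UndecidedWalk.

(** At equal times the positions for the two AI signals are opposite and nonzero, so the position
    reveals the signal. *)
Lemma undecided_inj (R : realType) (a b : R) x y j : 0 < a -> a < b ->
  undecided a b x j = undecided a b y j -> x = y.
Proof.
move=> a0 ab; rewrite /undecided /orient.
by case: x; case: y => //; case: (odd j); rewrite /= ?mul1r ?mul0r => ?; exfalso; lra.
Qed.

(** * Law of the signals given the state *)

Section Model.
Context d (T : measurableType d) (R : realType) (P : probability T R).
Context (theta c : {RV P >-> bool}) (s : nat -> {RV P >-> bool}).
Context (pi0 q alpha : R).
Hypothesis model : cascade_model theta c s pi0 q alpha.
Hypothesis q01 : 0 < q < 1.
Hypothesis alpha01 : 0 < alpha < 1.

Local Notation state t := (theta @^-1` [set t]).
Local Notation ploi := (public_log_odds theta c s pi0 q alpha).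

Lemma measurable_preimage (X : {RV P >-> bool}) (E : set bool) :
  measurable (X @^-1` E).
Proof. exact: measurable_funPTI. Qed.

Lemma preimage_negb (X : {RV P >-> bool}) b :
  X @^-1` [set ~~ b] = ~` (X @^-1` [set b]).
Proof.
by apply/seteqP; split=> w /=; case: (X w); case: b => //= /(_ erefl).
Qed.

Lemma state_gt0 t : 0 < fine (P (state t)).
Proof.
have [/andP[p0 p1] pT] := (prior_interior model, prior_state model).
case: t; rewrite ?pT//.
rewrite (preimage_negb theta true) probability_setC ?pT /= ?subr_gt0//.
exact: measurable_preimage.
Qed.

Lemma cond_prob_signal k b t :
  cond_prob P (signal c s k @^-1` [set b]) (state t) =
  likelihood (if k is Some _ then q else alpha) b t.
Proof.
have acc t' : cond_prob P (signal c s k @^-1` [set t']) (state t') =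
    if k is Some _ then q else alpha.
  by case: k => [i|]; [exact: (private_accuracy model) | exact: (AI_accuracy model)].
rewrite /likelihood; have [->|bt] := eqVneq b t; first exact: acc.
have -> : b = ~~ t by move: bt; case: b; case: t.
rewrite preimage_negb cond_prob_setC ?acc//; try exact: measurable_preimage.
exact/lt0r_neq0/state_gt0.
Qed.

Definition cylinder x (u : nat -> bool) n : set T :=
  [set w | c w = x /\ forall i, (i < n)%N -> s i w = u i].

Lemma cylinder_bigsetI x u n : cylinder x u n =
  \big[setI/setT]_(k <- None :: map Some (iota 0 n))
     (signal c s k @^-1` [set (if k is Some i then u i else x)]).
Proof.
rewrite big_cons big_map -bigcap_seq.
apply/seteqP; split=> w /= [cw sw]; split => // i; have := sw i; rewrite /= mem_iota //.
Qed.

Lemma measurable_cylinder x u n : measurable (cylinder x u n).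
Proof.
rewrite cylinder_bigsetI; apply: bigsetI_measurable => k _.
exact: measurable_preimage.
Qed.

Lemma cond_prob_cylinder x u n t :
  cond_prob P (cylinder x u n) (state t) =
  likelihood alpha x t * \prod_(i < n) likelihood q (u i) t.
Proof.
rewrite cylinder_bigsetI (@signals_independent _ _ _ _ _ _ _ _ _ _ model t _
  (fun k => [set (if k is Some i then u i else x)])); last first.
  rewrite /= map_inj_uniq ?iota_uniq ?andbT; last by move=> i j [].
  by apply/mapP => -[].
rewrite big_cons big_map cond_prob_signal; congr (_ * _).
rewrite -[n in iota 0 n]subn0 big_mkord.
by apply: eq_bigr => i _; rewrite cond_prob_signal.
Qed.

Lemma likelihood_gt0 r b t : 0 < r < 1 -> 0 < likelihood r b t :> R.
Proof. by rewrite /likelihood => /andP[r0 r1]; case: ifP => // _; lra. Qed.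

Lemma cond_prob_cylinder_gt0 x u n t :
  0 < cond_prob P (cylinder x u n) (state t).
Proof.
rewrite cond_prob_cylinder mulr_gt0 ?likelihood_gt0//.
by apply: prodr_gt0 => i _; exact: likelihood_gt0.
Qed.

Lemma fine_cylinderI x u n t : fine (P (cylinder x u n `&` state t)) =
  cond_prob P (cylinder x u n) (state t) * fine (P (state t)).
Proof. by rewrite /cond_prob divfK//; exact/lt0r_neq0/state_gt0. Qed.

(** * Evidence carried by a judgment *)

(** Each likelihood is 1, or the junk value 0 on a null event; their ratio is then 0 or 1, and [ln]
    vanishes at both. *)
Lemma evidence_constant (p : T -> R) (J : T -> bool) w :
  (forall w', p w' = p w -> J w' = J w) -> evidence theta p J w = 0.
Proof.
move=> pJ; rewrite /evidence.
have lik t : let B := state t `&` p @^-1` [set p w] in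
    cond_prob P (J @^-1` [set J w]) B = (fine (P B) != 0)%:R.
  move=> B; rewrite /cond_prob setIidr; last by move=> w' [_ /pJ].
  by have [->|B0] := eqVneq; rewrite ?mul0r// divff.
rewrite !lik; do 2 case: (_ != _); rewrite ?divr1 ?invr0 ?mulr0 ?ln1 ?ln0//.
Qed.

(** The likelihood is a ratio of probabilities of cylinders of lengths [j.+1] and [j]; by
    independence only the factor of signal [j] survives. *)
Lemma evidence_cylinder (p : T -> R) (J : T -> bool) w j :
  p @^-1` [set p w] = cylinder (c w) (s^~ w) j ->
  (forall w', p w' = p w -> J w' = s j w') ->
  evidence theta p J w = lambda (s j w) q.
Proof.
move=> pw pJ; rewrite /evidence -ln_likelihood//.
have lik t : cond_prob P (J @^-1` [set J w]) (state t `&` p @^-1` [set p w]) =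
    likelihood q (s j w) t.
  rewrite {1}/cond_prob.
  have -> : J @^-1` [set J w] `&` (state t `&` p @^-1` [set p w]) =
      cylinder (c w) (s^~ w) j.+1 `&` state t.
    rewrite pJ// pw setICA [RHS]setIC; congr (_ `&` _).
    apply/seteqP; split=> w' /=.
      move=> [Jw' pw'].
      have : p w' = p w by move: pw'; rewrite -pw.
      move/pJ => Jw''; move: pw' => [cw' sw']; split => // i.
      rewrite ltnS leq_eqVlt => /orP[/eqP ->|]; last exact: sw'.
      by rewrite -Jw''.
    move=> [cw' sw'].
    have pw' : cylinder (c w) (s^~ w) j w'.
      by split => // i ij; apply: sw'; exact: ltnW.
    split => //; rewrite pJ ?sw'//.
    by move: pw'; rewrite -pw.
  rewrite pw [X in _ / fine (P X)]setIC !fine_cylinderI.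
  rewrite -mulf_div divff ?mulr1; last exact/lt0r_neq0/state_gt0.
  have := cond_prob_cylinder_gt0 (c w) (s^~ w) j t.
  rewrite !cond_prob_cylinder big_ord_recr/= mulrA => /lt0r_neq0 h.
  by rewrite mulrAC divff// mul1r.
by rewrite !lik.
Qed.

(** * Absorption in a cascade *)

Hypothesis symmetric_prior : log_odds pi0 = 0.
Hypothesis q_gt0 : 0 < log_odds q.
Hypothesis alpha_gt0 : 0 < log_odds alpha.

Lemma public_log_odds0 w : ploi 0 w = lambda (c w) alpha.
Proof. by rewrite /= symmetric_prior add0r. Qed.

(** In the cascade region the judgment is determined by the public log-odds, so it carries no
    evidence. *)
Lemma public_log_odds_absorbed j w : log_odds q <= `|ploi j w| ->
  forall n, (j <= n)%N -> ploi n w = ploi j w.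
Proof.
move=> qp; elim=> [|n IH]; first by rewrite leqn0 => /eqP ->.
rewrite leq_eqVlt => /orP[/eqP -> //|]; rewrite ltnS => /IH pn.
rewrite /= evidence_constant ?addr0// => w' ->; rewrite pn.
move: qp; rewrite ler_normr => /orP[qp|qp]; first by rewrite !judgment_up.
by rewrite !judgment_down// lerNr.
Qed.

Lemma final_direction_absorbed j w : log_odds q <= `|ploi j w| ->
  final_direction theta c s pi0 q alpha w = Num.sg (ploi j w).
Proof.
move=> qp; apply: cvg_lim => //; apply: cvg_near_cst; near=> n.
congr (Num.sg _); apply: public_log_odds_absorbed => //.
by near: n; exact: nbhs_infty_ge.
Unshelve. all: by end_near. Qed.

Lemma final_direction_strong_AI w : log_odds q <= log_odds alpha ->
  final_direction theta c s pi0 q alpha w = Num.sg (lambda (c w) alpha).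
Proof.
move=> qa; rewrite (@final_direction_absorbed 0) public_log_odds0//.
by apply: le_trans qa _; rewrite lambdaE; case: (c w); rewrite ?normrN ler_norm.
Qed.

(** * The walk when the AI is less accurate than the users *)

Hypothesis alpha_lt_q : log_odds alpha < log_odds q.


Local Notation walk := (undecided (log_odds alpha) (log_odds q)).

Definition tied j : set T := [set w | cylinder (c w) (alternating (c w)) j w].

Lemma tiedS j w : tied j.+1 w <-> tied j w /\ s j w = alternating (c w) j.
Proof.
split=> [[_ sw]|[[_ sw] sj]].
  by split; [split=> // i ij; apply/sw/ltnW | exact: sw].
by split=> // i; rewrite ltnS leq_eqVlt => /orP[/eqP ->//|]; exact: sw.
Qed.

(** Quantified over all [w] because evidence is computed from every sample point with the same
    log-odds. *)
Definition decided_unless_tied j : Prop := forall w,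
  (tied j w -> ploi j w = walk (c w) j) /\
  (~ tied j w -> log_odds q <= `|ploi j w|).

(* While the public log-odds are undecided, their value reveals the AI signal
   and all past private signals, so the next private signal, which is the next
   judgment, is conditionally independent of them. *)
Lemma public_log_odds_step j w : decided_unless_tied j -> tied j w ->
  ploi j.+1 w = walk (c w) j + orient (s j w) (log_odds q).
Proof.
move=> dj tw; have pw := (dj w).1 tw.
have small : `|ploi j w| < log_odds q by rewrite pw undecided_small.
rewrite -pw -lambdaE /= (@evidence_cylinder _ _ _ j)//; last first.
  by move=> w' pw'; rewrite judgment_free// pw'; exact: small.
apply/seteqP; split=> w' [].
  (* Off the tied event the log-odds have modulus at least [log_odds q], so they cannot equal the
     small value at [w]. *)
  move=> pw'; have tw' : tied j w'.
    apply: contrapT => /(dj w').2; rewrite pw' => /(lt_le_trans small).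
    by rewrite ltxx.
  have cw' : c w' = c w.
    by apply: (@undecided_inj _ _ _ _ _ j alpha_gt0 alpha_lt_q); rewrite -(dj w').1// pw'.
  by split=> // i ij; rewrite tw'.2// tw.2// cw'.
move=> cw' sw'; change (ploi j w' = ploi j w); rewrite pw (dj w').1 ?cw'//.
by split=> // i ij; rewrite sw'// tw.2// cw'.
Qed.

Lemma public_log_odds_walk j : decided_unless_tied j.
Proof.
elim: j => [|j IH] w.
  split=> [_|]; last by case.
  by rewrite public_log_odds0 lambdaE /undecided mul0r subr0.
have [tw|ntw] := pselect (tied j w); last first.
  have pw := (IH w).2 ntw; split=> [/tiedS[]//|_].
  by rewrite (@public_log_odds_absorbed j).
rewrite (public_log_odds_step IH tw).
split=> [/tiedS[_ ->]|ntw]; first by rewrite undecidedS.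
apply: undecided_exit => //.
by apply/eqP => sw; apply: ntw; apply/tiedS.
Qed.

(** If no even user joins the AI, the walk stays tied forever or is absorbed on the other side.
    Either way its oriented value is negative at all odd times, so its sign cannot converge to that
    of the AI. *)
Lemma final_directionE w :
  final_direction theta c s pi0 q alpha w = Num.sg (lambda (c w) alpha) <->
  exists k, tied k.*2 w /\ s k.*2 w = c w.
Proof.
have step j : tied j w -> _ := public_log_odds_step (@public_log_odds_walk j).
split=> [|[k [tw sw]]]; last first.
  have := step _ tw; rewrite undecided_join ?odd_double// => pw.
  rewrite (@final_direction_absorbed k.*2.+1) pw; first by rewrite lambdaE sgr_orient_joined.
  by rewrite (@ler_norm_orient _ (c w))// orientK lerDr ltW.
apply: contraPP => noesc.
have tied_or_left j : tied j w \/ orient (c w) (ploi j w) <= - log_odds q.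
  elim: j => [|j [tw|pw]]; first by left.
    have [sj|sj] := eqVneq (s j w) (alternating (c w) j).
      by left; apply/tiedS.
    (* Breaking the alternation at an even time would mean joining the AI. *)
    have oj : odd j.
      apply/negPn/negP => ej; apply: noesc; exists j./2.
      rewrite even_halfK//; split=> //.
      move: sj; rewrite /alternating (negbTE ej).
      by case: (c w); case: (s j w).
    by right; rewrite step// undecided_leave.
  right; rewrite (@public_log_odds_absorbed j)//.
  rewrite -(norm_orient (c w)) ler_normr; apply/orP; right.
  by rewrite lerNr.
have neg j : odd j -> orient (c w) (ploi j w) < 0.
  move=> oj; case: (tied_or_left j) => [tw|/le_lt_trans]; last first.
    by apply; rewrite oppr_lt0.
  by rewrite (public_log_odds_walk j w).1// undecided_odd_lt0.
rewrite lambdaE.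
have e0 : Num.sg (orient (c w) (log_odds alpha)) != 0 :> R.
  by rewrite sgr_eq0 -normr_eq0 norm_orient normr_eq0 gt_eqF.
move=> /(final_directionP _ _ _ _ _ _ _ e0)/cvgrPdist_lt/(_ 1 ltr01)[N _].
(* An odd time beyond the convergence threshold [N]. *)
have leN : (N <= N.*2.+1)%N by rewrite -addnn leqW// leq_addr.
move=> /(_ _ leN).
rewrite ltNge => /negP; apply; apply/ltW/sgr_orient_far => //.
by apply: neg; rewrite /= odd_double.
Qed.

(** * Summation over the time of joining *)

Definition joining x k : set T :=
  cylinder x (fun i => if i == k.*2 then x else alternating x i) k.*2.+1.

Lemma joiningP x k w :
  joining x k w <-> [/\ c w = x, tied k.*2 w & s k.*2 w = c w].
Proof.
split=> [[cw sw]|[<- [_ tw] sw]].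
  split=> //; last by rewrite sw ?eqxx ?cw.
  by split=> // i ik; rewrite sw ?cw ?ltn_eqF// ltnW.
split=> // i; rewrite ltnS leq_eqVlt; case: eqP => [->//|_] /=; exact: tw.
Qed.

(** Joining at time [k.*2] breaks the alternation that any later joining requires. *)
Lemma trivIset_joining x (B : set T) :
  trivIset setT (fun k => joining x k `&` B).
Proof.
suff disj k l w : (k < l)%N -> joining x k w -> joining x l w -> False.
  move=> k l _ _ [w [[wk _] [wl _]]]; case: (ltngtP k l) => // kl; exfalso.
    exact: (disj _ _ _ kl wk wl).
  exact: (disj _ _ _ kl wl wk).
move=> kl /joiningP[_ _ sk] /joiningP[_ [_ /(_ k.*2)]]; rewrite ltn_double kl.
by rewrite sk /alternating odd_double => /(_ isT); case: (c w).
Qed.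

(** Each alternating pair has one correct and one wrong signal, a factor [q * (1 - q)] in either
    state; the joining signal gives [r]. *)
Lemma cond_prob_joining x k t : let r := likelihood q x t in
  cond_prob P (joining x k) (state t) =
  likelihood alpha x t * geometric r (q * (1 - q)) k.
Proof.
move=> r; rewrite cond_prob_cylinder big_ord_recr/= eqxx.
congr (_ * _); rewrite mulrC; congr (_ * _).
under eq_bigr => i _ do rewrite ltn_eqF//.
elim: k => [|k IH]; first by rewrite big_ord0.
rewrite doubleS !big_ord_recr/= IH exprSr -mulrA; congr (_ * _).
rewrite /alternating /= odd_double /likelihood.
by case: x {r IH}; case: t => //=; rewrite mulrC.
Qed.

Lemma final_direction_bigcup x t :
  [set w | final_direction theta c s pi0 q alpha w = Num.sg (lambda x alpha)]
    `&` (c @^-1` [set x] `&` state t) =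
  \bigcup_k (joining x k `&` state t).
Proof.
apply/seteqP; split=> w.
  move=> [/= Dw [cw tw]]; move: Dw; rewrite -cw => /final_directionE[k [tk sk]].
  by exists k => //; split=> //; apply/joiningP.
move=> [k _ [/joiningP[cw tk sk] tw]]; split=> //=.
by rewrite -cw; apply/final_directionE; exists k.
Qed.

Lemma cond_prob_final_direction x t :
  cond_prob P
    [set w | final_direction theta c s pi0 q alpha w = Num.sg (lambda x alpha)]
    (c @^-1` [set x] `&` state t) =
  likelihood q x t / (1 - q * (1 - q)).
Proof.
set r := likelihood q x t; set p := fine (P (state t)).
have p0 : p != 0 by exact/lt0r_neq0/state_gt0.
have l0 : likelihood alpha x t != 0 by exact/lt0r_neq0/likelihood_gt0.
rewrite /cond_prob final_direction_bigcup.
have -> : fine (P (c @^-1` [set x] `&` state t)) = likelihood alpha x t * p.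
  by rewrite -(cond_prob_signal None) /cond_prob divfK.
have mJ k : measurable (joining x k `&` state t).
  by apply: measurableI; [exact: measurable_cylinder | exact: measurable_preimage].
rewrite measure_semi_bigcup//; last 2 first.
- exact: trivIset_joining.
- exact: bigcup_measurable.
have PJ k : P (joining x k `&` state t) =
    (geometric (likelihood alpha x t * p * r) (q * (1 - q)) k)%:E.
  rewrite -[LHS]fineK ?fin_num_measure// fine_cylinderI -/(joining x k).
  by rewrite cond_prob_joining /= mulrAC !mulrA.
have q1 : `|q * (1 - q)| < 1.
  by move: q01 => /andP[q0 q1]; rewrite ger0_norm; nra.
have -> : (\sum_(k <oo) P (joining x k `&` state t))%E =
    (likelihood alpha x t * p * r / (1 - q * (1 - q)))%:E.
  apply: cvg_lim => //; under eq_fun do under eq_bigr do rewrite PJ.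
  apply: cvg_EFin; first by apply: nearW => n; rewrite sumEFin.
  rewrite (_ : _ \o _ =
    series (geometric (likelihood alpha x t * p * r) (q * (1 - q)))).
    exact: cvg_geometric_series.
  by apply/funext => n; rewrite /= sumEFin.
(* The probability of the conditioning event cancels. *)
by rewrite /= [_ * r]mulrC mulrAC mulfK// mulf_neq0.
Qed.

End Model.

(** * From log-odds back to accuracies *)

Unset Implicit Arguments.

Theorem theorem7 (d : measure_display) (T : measurableType d) (R : realType)
    (P : probability T R) (theta c : {RV P >-> bool})
    (s : nat -> {RV P >-> bool}) (pi0 q alpha : R)
    (model : cascade_model theta c s pi0 q alpha)
    (symmetric_prior : log_odds pi0 = 0)
    (q_range : 1 / 2 < q < 1) (alpha_range : 1 / 2 < alpha < 1) :
  let D := final_direction theta c s pi0 q alpha in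
  (q <= alpha ->
     forall (x : bool) (w : T), c w = x -> D w = Num.sg (lambda x alpha)) /\
  (alpha < q ->
     forall x t : bool,
       cond_prob P [set w | D w = Num.sg (lambda x alpha)]
         (c @^-1` [set x] `&` theta @^-1` [set t]) =
       if x == t then q / (1 - q + q ^+ 2)
       else (1 - q) / (1 - q + q ^+ 2)).
Proof.
have [q0 alpha0] := (log_odds_gt0 q_range, log_odds_gt0 alpha_range).
have q01 : 0 < q < 1 by move: q_range => /andP[? ?]; apply/andP; split; lra.
have alpha01 : 0 < alpha < 1.
  by move: alpha_range => /andP[? ?]; apply/andP; split; lra.
have odds_gt0 (r : R) : 0 < r < 1 -> r / (1 - r) \is Num.pos.
  by move=> /andP[r0 r1]; rewrite qualifE/= divr_gt0 ?subr_gt0.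
(* Log-odds increase strictly with accuracy, so the two regimes can be stated in either scale. *)
have log_oddsE : (log_odds alpha < log_odds q) = (alpha < q).
  rewrite /log_odds ltr_ln ?odds_gt0//.
  have [/andP[? ?] /andP[? ?]] := (q01, alpha01).
  rewrite ltr_pdivrMr ?subr_gt0// mulrAC ltr_pdivlMr ?subr_gt0//.
  by apply/idP/idP; lra.
split=> [qa x w <-|aq x t].
  by apply: final_direction_strong_AI => //; rewrite leNgt log_oddsE -leNgt.
rewrite (cond_prob_final_direction model)//; last by rewrite log_oddsE.
have -> : 1 - q + q ^+ 2 = 1 - q * (1 - q) by ring.
by rewrite /likelihood; case: eqP.
Qed.
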